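(* Let $p\in(2,3)$ and let $S\in\Omega_p$ be a price path. Let $\mathcal{Z}$ be a Borel measurable subset of $C^2_b(\mathbb{R}^d;\mathbb{R}^d)$ and let $\nu$ be a probability measure on $\mathcal{Z}$. If $$\int_{\mathcal{Z}}\|f\|_{C^2_b}\,\mathrm{d}\nu(f)<\infty,$$ then Cover's universal portfolio $\phi^\nu$, defined by $$\phi^\nu_t:=\int_{\mathcal{Z}}f(S_t)\,\mathrm{d}\nu(f),\qquad t\in[0,\infty),$$ is an admissible strategy with respect to $S$.
   Context: Fix $d\in\mathbb{N}$. $D([0,T];E)$ is the space of càdlàg functions $[0,T]\to E$, and $\Delta_{[0,T]}:=\{(s,t)\in[0,T]^2:s\le t\}$. For a path $A$ write $A_{s,t}:=A_t-A_s$; for a two-parameter function, $A_{s,t}$ is its value at $(s,t)$. $|\mathcal{P}|$ is the mesh size of a partition, and $[u,v]\in\mathcal P$ means that $u<v$ are consecutive points. $(a\otimes b)^{ij}=a^ib^j$. $C^2_b(\mathbb{R}^d;\mathbb{R}^d)$: twice continuously differentiable functions with $\|f\|_{C^2_b}:=\|f\|_\infty+\|\mathrm{D}f\|_\infty+\|\mathrm{D}^2f\|_\infty<\infty$. $p$-variation ($p\ge1$): $\|A\|_{p,[s,t]}:=\big(\sup_{\mathcal{P}}\sum_{[u,v]\in\mathcal{P}}|A_{u,v}|^p\big)^{1/p}$, the supremum being over finite partitions of $[s,t]$ (for paths or two-parameter functions). $D^p$: càdlàg paths on $[0,T]$ of finite $p$-variation. $D^p_2$: functions on $\Delta_{[0,T]}$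 of finite $p$-variation, càdlàg in each variable separately. A control function is a map $w:\Delta_{[0,T]}\to[0,\infty)$ with $w(s,u)+w(u,t)\le w(s,t)$ for $s\le u\le t$. Property (RIE): Let $p\in(2,3)$ and let $\mathcal{P}^n=\{0=t^n_0<\cdots<t^n_{N_n}=T\}$, $n\in\mathbb{N}$, be nested partitions ($\mathcal{P}^n\subset\mathcal{P}^{n+1}$) of $[0,T]$ with $|\mathcal{P}^n|\to0$. For $S\in D([0,T];\mathbb{R}^d)$ set $S^n_t=S_T\mathbf{1}_{\{T\}}(t)+\sum_{k=0}^{N_n-1}S_{t^n_k}\mathbf{1}_{[t^n_k,t^n_{k+1})}(t)$ and $\int_0^tS^n_u\otimes\mathrm{d}S_u:=\sum_{k=0}^{N_n-1}S_{t^n_k}\otimes S_{t^n_k\wedge t,t^n_{k+1}\wedge t}$, with $\int_s^t:=\int_0^t-\int_0^s$. $S$ satisfies (RIE) with respect to $p$ and $(\mathcal{P}^n)$ if: (a) $S^n\to S$ uniformly; (b) $\int_0^\cdot S^n_u\otimes\mathrm{d}S_u$ converges uniformly on $[0,T]$; (c) there is a control function $w$ such that (with $\frac00:=0$) $$\sup_{(s,t)\in\Delta_{[0,T]}}\frac{|S_{s,t}|^p}{w(s,t)}+\sup_{n}\sup_{0\le k<\ell\le N_n}\frac{\big|\int_{t^n_k}^{t^n_\ell}S^n_u\otimes\mathrm{d}S_u-S_{t^n_k}\otimes S_{t^n_k,t^n_\ell}\big|^{p/2}}{w(t^n_k,t^n_\ell)}\le1.$$ Price path: $S\in D([0,\infty);\mathbb{R}^d)$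 is a price path, $S\in\Omega_p$, if there is a nested sequence of locally finite partitions $(\mathcal{P}^n)$ of $[0,\infty)$ with mesh vanishing on compacts such that for all $T>0$ the restriction $S|_{[0,T]}$ satisfies (RIE) with respect to $p$ and $(\mathcal{P}^n([0,T]))_n$, where $\mathcal{P}^n([0,T]):=(\mathcal{P}^n\cup\{0,T\})\cap[0,T]$. Controlled paths: for $q\ge p$ with $2/p+1/q>1$ and $1/r=1/p+1/q$, $(F,F')\in\mathcal{V}^{q,r}_S$ (on $[0,T]$) means $F\in D^p([0,T];\mathbb{R}^d)$, $F'\in D^q([0,T];\mathcal{L}(\mathbb{R}^d;\mathbb{R}^d))$ and $R^F\in D^r_2(\Delta_{[0,T]};\mathbb{R}^d)$, where $R^F_{s,t}:=F_{s,t}-F'_sS_{s,t}$. Admissible strategy: $\phi:[0,\infty)\to\mathbb{R}^d$ is admissible with respect to $S\in\Omega_p$ if there exist $q\ge p$, $r>1$ with $2/p+1/q>1$, $1/r=1/p+1/q$ such that for every $T>0$ there is $\phi':[0,T]\to\mathcal{L}(\mathbb{R}^d;\mathbb{R}^d)$ with $(\phi,\phi')\in\mathcal{V}^{q,r}_S$ on $[0,T]$, and if the set of jump times of $\phi$ in $(0,\infty)$ is contained in $\bigcup_n\mathcal{P}^n$, where $(\mathcal{P}^n)$ is the sequence of partitions associated with $S$. *)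

(* Defs.v *)
(* MathComp-Analysis, over an arbitrary R : realType.

   R^d is 'rV[R]_d and L(R^d; R^d) is 'M[R]_d acting on row vectors on the
   right, v |-> v *m A, as in the library's jacobian; norms are those of the
   library (maximum of the entries).  A path on [0, T] or [0, +oo) is a total
   function on R of which only the values on that interval are used. *)
From HB Require Import structures.
From mathcomp Require Import all_boot all_order all_algebra.
From mathcomp Require Import finmap.
From mathcomp Require Import all_classical all_reals all_analysis.

Set Implicit Arguments.
Unset Strict Implicit.
Unset Printing Implicit Defensive.

Import Order.TTheory GRing.Theory Num.Theory.
Import numFieldNormedType.Exports.

Local Open Scope classical_set_scope.
Local Open Scope ring_scope.

Section paths.
Context {R : realType} {V : normedModType R}.

(* Càdlàg on [a, b] if b is finite, on [a, +oo) if b = +oo. *)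
Definition cadlag (a : R) (b : \bar R) (X : R -> V) : Prop :=
  (forall t, a <= t -> (t%:E < b)%E -> X x @[x --> t^'+] --> X t) /\
  (forall t, a < t -> (t%:E <= b)%E -> cvg (X x @[x --> t^'-])).

Definition jump_time (X : R -> V) (t : R) : Prop :=
  lim (X x @[x --> t^'-]) <> X t.

Definition incr (X : R -> V) (s t : R) : V := X t - X s.

(* In itv_partition s t pi the initial point s is not listed in pi. *)
Definition p_variation (p : R) (A : R -> R -> V) (s t : R) : \bar R :=
  (ereal_sup
     [set (\sum_(k < size pi) `|A (nth t (s :: pi) k) (nth t pi k)| `^ p)%:E
     | pi in itv_partition s t] `^ p^-1)%E.

Definition Dp (p T : R) (X : R -> V) : Prop :=
  cadlag 0 T%:E X /\ (p_variation p (incr X) 0 T < +oo)%E.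

Definition Dp2 (p T : R) (A : R -> R -> V) : Prop :=
  [/\ forall s, 0 <= s <= T -> cadlag s T%:E (fun t => A s t),
      forall t, 0 <= t <= T -> cadlag 0 t%:E (fun s => A s t)
    & (p_variation p A 0 T < +oo)%E].

End paths.

Definition control {R : realType} (T : R) (w : R -> R -> R) : Prop :=
  (forall s t, 0 <= s -> s <= t -> t <= T -> 0 <= w s t) /\
  (forall s u t, 0 <= s -> s <= u -> u <= t -> t <= T ->
     w s u + w u t <= w s t).

Section partitions.
Context {R : realType}.

(* Here a partition {t_0 < ... < t_N} of [0, T] is the increasing list of all
   its points, t_0 = 0 and t_N = T included. *)
Definition psteps (pi : seq R) : nat := (size pi).-1.

Definition mesh (pi : seq R) : R :=
  \big[Num.max/0]_(k < psteps pi) (pi`_k.+1 - pi`_k).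

Definition locally_finite_partition (P : set R) : Prop :=
  [/\ P 0, P `<=` `[0, +oo[ & forall T, finite_set (P `&` `[0, T])].

(* (P `|` {0, T}) `&` [0, T], listed increasingly. *)
Definition prestr (P : set R) (T : R) : seq R :=
  sort <=%R (enum_fset (fset_set ((P `|` [set 0; T]) `&` `[0, T]))).

End partitions.

Section rough.
Context {R : realType} {d : nat}.
Implicit Types (S F phi : R -> 'rV[R]_d) (pi : seq R).

Definition tens (a b : 'rV[R]_d) : 'M[R]_d := \matrix_(i, j) (a ord0 i * b ord0 j).

Definition step_path S pi (T t : R) : 'rV[R]_d :=
  \1_[set T] t *: S T +
  \sum_(k < psteps pi) \1_(`[pi`_k, pi`_k.+1[%classic) t *: S pi`_k.

Definition step_int S pi (t : R) : 'M[R]_d :=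
  \sum_(k < psteps pi)
    tens (S pi`_k) (incr S (Num.min pi`_k t) (Num.min pi`_k.+1 t)).

(* In \bar R the library has 0%:E^-1 = +oo and 0 * +oo = 0, so that 0 / 0 = 0
   and x / 0 = +oo for x > 0. *)
Definition RIE_path_ratios (p T : R) (w : R -> R -> R) S : set (\bar R) :=
  [set x | exists s t, [/\ 0 <= s, s <= t, t <= T &
     x = ((`|incr S s t| `^ p)%:E / (w s t)%:E)%E]].

Definition RIE_area_ratios (p : R) (pi : nat -> seq R) (w : R -> R -> R) S :
    set (\bar R) :=
  [set x | exists n k l, [/\ (k < l)%N, (l <= psteps (pi n))%N &
     let tk := (pi n)`_k in let tl := (pi n)`_l in
     x = ((`|incr (step_int S (pi n)) tk tl - tens (S tk) (incr S tk tl)|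
             `^ (p / 2))%:E / (w tk tl)%:E)%E]].

Definition RIE (p : R) (pi : nat -> seq R) (T : R) S : Prop :=
  [/\ {uniform `[0, T], (fun n => step_path S (pi n) T) @ \oo --> S},
      exists I : R -> 'M[R]_d,
        {uniform `[0, T], (fun n => step_int S (pi n)) @ \oo --> I}
    & exists2 w : R -> R -> R, control T w &
      (ereal_sup (RIE_path_ratios p T w S) +
       ereal_sup (RIE_area_ratios p pi w S) <= 1)%E].

(* S is a price path (S \in Omega_p) and P is the sequence of partitions
   associated with it. *)
Definition price_path (p : R) (P : nat -> set R) S : Prop :=
  [/\ cadlag 0 +oo%E S,
      forall n, locally_finite_partition (P n),
      forall n, P n `<=` P n.+1,
      forall T : R, 0 < T -> mesh (prestr (P n) T) @[n --> \oo] --> (0 : R)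
    & forall T : R, 0 < T -> RIE p (fun n => prestr (P n) T) T S].

Definition controlled (p q r T : R) S F (F' : R -> 'M[R]_d) : Prop :=
  [/\ Dp p T F, Dp q T F' &
      Dp2 r T (fun s t => incr F s t - incr S s t *m F' s)].

Definition admissible (p : R) (P : nat -> set R) S phi : Prop :=
  (exists q r : R,
    [/\ p <= q, 1 < r, 1 < 2 / p + 1 / q, 1 / r = 1 / p + 1 / q &
        forall T : R, 0 < T ->
          exists phi' : R -> 'M[R]_d, controlled p q r T S phi phi']) /\
  (forall t : R, 0 < t -> jump_time phi t -> exists n, P n t).

End rough.

Section C2b.
Context {R : realType} {d : nat}.
Implicit Types f : 'rV[R]_d -> 'rV[R]_d.

Definition sup_norm {V : normedModType R} (g : 'rV[R]_d -> V) : \bar R :=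
  ereal_sup [set `|g x|%:E | x in setT].

Definition D1 f (x : 'rV[R]_d) : 'M[R]_d := jacobian f x.

(* Derivative of x |-> D1 f x, the d x d matrices being flattened to rows. *)
Definition D2 f (x : 'rV[R]_d) : 'M[R]_(d, d * d) :=
  jacobian (fun y => mxvec (D1 f y)) x.

Definition is_C2 f : Prop :=
  [/\ forall x : 'rV[R]_d, differentiable f x,
      forall x : 'rV[R]_d, differentiable (fun y => mxvec (D1 f y)) x
    & continuous (D2 f)].

Definition C2b_norm f : \bar R :=
  (sup_norm f + sup_norm (D1 f) + sup_norm (D2 f))%E.

Lemma D1_cst0 : D1 (cst 0) = cst 0.
Proof.
apply/funext => x; apply/matrixP => i j.
by rewrite /D1 /jacobian mxE diff_cst /= !mxE.
Qed.

Lemma D2_cst0 : D2 (cst 0) = cst 0.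
Proof.
apply/funext => x; apply/matrixP => i j; rewrite /D2 D1_cst0.
have -> : (fun y : 'rV[R]_d => mxvec ((cst 0 : 'rV[R]_d -> 'M[R]_d) y)) = cst 0.
  by apply/funext => y /=; rewrite linear0.
by rewrite /jacobian mxE diff_cst /= !mxE.
Qed.

Lemma sup_norm0 (V : normedModType R) :
  sup_norm (cst 0 : 'rV[R]_d -> V) = 0%E.
Proof.
rewrite /sup_norm (_ : [set _ | _ in _] = [set 0%E]) ?ereal_sup1//.
apply/seteqP; split => [_ [x _ <-]|_ ->] /=; first by rewrite normr0.
by exists 0 => //=; rewrite normr0.
Qed.

Lemma cst0_C2b : is_C2 (cst 0) /\ (C2b_norm (cst 0%R) < +oo)%E.
Proof.
split; last by rewrite /C2b_norm D1_cst0 D2_cst0 !sup_norm0 !adde0 ltry.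
split; [by move=> x; exact: differentiable_cst | | ].
  move=> x; rewrite D1_cst0.
  have -> : (fun y : 'rV[R]_d => mxvec ((cst 0 : 'rV[R]_d -> 'M[R]_d) y)) = cst 0.
    by apply/funext => y /=; rewrite linear0.
  exact: differentiable_cst.
by rewrite D2_cst0 => x; exact: cst_continuous.
Qed.

End C2b.

Record C2b (R : realType) (d : nat) := MkC2b {
  C2b_fun :> 'rV[R]_d -> 'rV[R]_d ;
  C2b_prop : is_C2 C2b_fun /\ (C2b_norm C2b_fun < +oo)%E }.

Section C2b_borel.
Context {R : realType} {d : nat}.

HB.instance Definition _ := gen_eqMixin (C2b R d).
HB.instance Definition _ := gen_choiceMixin (C2b R d).
HB.instance Definition _ := isPointed.Build (C2b R d) (MkC2b cst0_C2b).

Definition C2b_open (U : set (C2b R d)) : Prop :=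
  forall f, U f -> exists2 e : R, 0 < e &
    forall g : C2b R d, (C2b_norm (g \- f)%R < e%:E)%E -> U g.

(* Borel sigma-algebra of the norm topology. *)
HB.instance Definition _ :=
  Measurable.copy (C2b R d) (g_sigma_algebraType C2b_open).

End C2b_borel.

Section portfolio.
Context {R : realType} {d : nat}.

(* The R^d-valued integral is taken coordinatewise. *)
Definition universal_portfolio (Z : set (C2b R d)) (nu : probability (C2b R d) R)
    (S : R -> 'rV[R]_d) (t : R) : 'rV[R]_d :=
  \row_(i < d) (\int[nu]_(f in Z) (f (S t) ord0 i))%R.

End portfolio.

(* Main.v *)
Require Import Defs.
From HB Require Import structures.
From mathcomp Require Import all_boot all_order all_algebra.
From mathcomp Require Import all_classical all_reals all_analysis.
From mathcomp Require Import measurable_realfun ring.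
Set Implicit Arguments.
Unset Strict Implicit.
Unset Printing Implicit Defensive.
Import Order.TTheory GRing.Theory Num.Theory.
Import numFieldNormedType.Exports.
Local Open Scope classical_set_scope.
Local Open Scope ring_scope.

(* The portfolio is a fixed function of the price, phi = G o S with
   G x = int f x dnu(f), and its Gubinelli derivative is G' o S with
   G' x = int D1 f x dnu(f).  The mean value theorem bounds |f y - f x|,
   |D1 f y - D1 f x| and |f y - f x - (y - x) D1 f x| by constants depending
   only on d times the C^2_b norm of f and |y - x|, |y - x| and |y - x|^2; this
   integrates to the same bounds for G and G'.  Since |S_{s,t}|^p is controlled,
   phi and phi' have finite p-variation and the remainder finite
   p/2-variation, so q = p and r = p/2 work.  G being continuous, phi jumps only
   where S does, and S, a uniform limit of step functions, jumps only at
   partition points. *)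

(** * Maximum norm of matrices and entrywise limits *)

Lemma norm_mx_le (R : realType) (m n : nat) (A : 'M[R]_(m, n)) (c : R) :
  0 <= c -> (forall i j, `|A i j| <= c) -> `|A| <= c.
Proof.
move=> c0 Ac; rewrite [leLHS]/Num.Def.normr /= mx_normrE.
by apply: bigmax_le => // -[i j] _; exact: Ac.
Qed.

Lemma norm_entry_le (R : realType) (m n : nat) (A : 'M[R]_(m, n)) i j :
  `|A i j| <= `|A|.
Proof.
rewrite [leRHS]/Num.Def.normr /= mx_normrE.
by apply/bigmax_geP; right => /=; exists (i, j).
Qed.

Lemma norm_entryB_le (R : realType) (m n : nat) (A B : 'M[R]_(m, n)) i j :
  `|A i j - B i j| <= `|A - B|.
Proof. by have := norm_entry_le (A - B) i j; rewrite !mxE. Qed.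

(** The maximum norm is submultiplicative only up to the number [d] of terms in each entry; the
    factors [d%:R] in the later constants stem from here. *)
Lemma norm_mulmx_le (R : realType) (d m n : nat) (v : 'M[R]_(m, d))
    (A : 'M[R]_(d, n)) : `|v *m A| <= d%:R * `|v| * `|A|.
Proof.
apply: norm_mx_le => [|i j]; first by rewrite !mulr_ge0.
rewrite mxE (le_trans (ler_norm_sum _ _ _))//.
have -> : d%:R * `|v| * `|A| = \sum_(k < d) `|v| * `|A|.
  by rewrite sumr_const card_ord -mulrA mulr_natl.
by apply: ler_sum => k _; rewrite normrM ler_pM// norm_entry_le.
Qed.

Lemma cvg_mx (R : realType) (m n : nat) (T : Type) (F : set_system T)
    {FF : Filter F} (A : T -> 'M[R]_(m, n)) (B : 'M[R]_(m, n)) :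
  (forall i j, A x i j @[x --> F] --> B i j) -> A @ F --> B.
Proof.
move=> AB; apply/cvgrPdist_le => /= e e0.
have : \forall x \near F, forall ij : 'I_m * 'I_n,
    `|B ij.1 ij.2 - A x ij.1 ij.2| <= e.
  by apply: filter_forall => -[i j] /=; move/cvgrPdist_le : (AB i j); exact.
apply: filterS => x Ax; apply: norm_mx_le => [|i j]; first exact: ltW.
by rewrite !mxE; exact: Ax (i, j).
Qed.

Lemma cvg_mulmx (R : realType) (d m n : nat) (T : Type) (F : set_system T)
    {FF : Filter F} (u : T -> 'M[R]_(m, d)) (A : T -> 'M[R]_(d, n))
    (v : 'M[R]_(m, d)) (B : 'M[R]_(d, n)) :
  u @ F --> v -> A @ F --> B -> u x *m A x @[x --> F] --> v *m B.
Proof.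
move=> uv AB; apply: cvg_mx => i j; rewrite mxE.
under eq_fun do rewrite mxE.
apply: cvg_big => [|k _]; first exact: add_continuous.
apply: cvgM.
  exact: (continuous_cvg _ (@coord_continuous _ _ _ i k v) uv).
exact: (continuous_cvg _ (@coord_continuous _ _ _ k j B) AB).
Qed.

Lemma continuous_of_lipschitz (R : realType) (U V : normedModType R) (g : U -> V) (K : R) :
  (forall x y, `|g y - g x| <= K * `|y - x|) -> continuous g.
Proof.
move=> gK x; apply/cvgrPdist_lt => e e0.
(* [K] carries no sign, so [|K| + 1] serves as a positive Lipschitz constant. *)
have K0 : 0 < `|K| + 1 by rewrite ltr_wpDl.
have : \forall y \near x, `|x - y| < e / (`|K| + 1).
  by apply: cvgr_dist_lt => //; rewrite divr_gt0.
apply: filterS => y; rewrite ltr_pdivlMr// mulrC; apply: le_lt_trans.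
rewrite distrC (le_trans (gK _ _))// (distrC y) ler_wpM2r//.
by rewrite (le_trans (ler_norm _))// lerDl.
Qed.

(** * Bounds on the p-variation from a control *)

Section p_variation_control.
Context {R : realType} {V : normedModType R}.

(** Induction on the partition: superadditivity of [w] merges the first step with the bound on the
    rest, so the bound is the same for all partitions. *)
Lemma itv_partition_sum_control (p C T : R) (w : R -> R -> R)
    (A : R -> R -> V) (s t : R) (pi : seq R) :
  control T w -> 0 <= C ->
  (forall u v, 0 <= u -> u <= v -> v <= T -> `|A u v| `^ p <= C * w u v) ->
  0 <= s -> t <= T -> itv_partition s t pi ->
  \sum_(k < size pi) `|A (nth t (s :: pi) k) (nth t pi k)| `^ p <= C * w s t.
Proof.
move=> [w0 wD] C0 Aw s0 tT; elim: pi s s0 => [|u pi ih] s s0 spi.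
  have st := itv_partition_nil spi.
  by rewrite big_ord0 mulr_ge0// w0// st.
have su : s <= u by case: spi => /= /andP[/ltW].
have ut := itv_partition_le (itv_partition_cons spi).
have u0 := le_trans s0 su.
rewrite big_ord_recl /= (le_trans (lerD (Aw _ _ s0 su (le_trans ut tT))
  (ih _ u0 (itv_partition_cons spi))))//.
by rewrite -mulrDr ler_wpM2l// wD.
Qed.

Lemma p_variation_lty (p C T : R) (w : R -> R -> R) (A : R -> R -> V) :
  control T w -> 0 <= C ->
  (forall u v, 0 <= u -> u <= v -> v <= T -> `|A u v| `^ p <= C * w u v) ->
  (p_variation p A 0 T < +oo)%E.
Proof.
move=> cw C0 Aw; apply: poweR_lty.
apply: (@le_lt_trans _ _ (C * w 0 T)%:E); last exact: ltry.
apply: ge_ereal_sup => _ [pi /= ppi <-]; rewrite lee_fin.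
exact: (itv_partition_sum_control cw).
Qed.

End p_variation_control.

(** * Consequences of (RIE), jumps of the price path, and composition with regular maps *)

Section RIE_path.
Context {R : realType} {d : nat}.
Implicit Types (S : R -> 'rV[R]_d) (P : set R).

(** [fset_set] of an infinite set is empty, so local finiteness is what makes the list contain the
    intended points. *)
Lemma mem_prestr P (T t : R) : locally_finite_partition P ->
  (t \in prestr P T) = (t \in ((P `|` [set 0; T]) `&` `[0, T])).
Proof.
case=> _ _ Pfin; rewrite mem_sort in_fset_set ?inE//.
rewrite setIUl finite_setU; split; first exact: Pfin.
by apply: finite_setIl; exact: finite_set2.
Qed.

(** 0 and [T] are distinct members of the list. The resulting step provides an area ratio, so that
    the second supremum in [RIE] is not over the empty set. *)
Lemma psteps_prestr_gt0 P (T : R) : locally_finite_partition P -> 0 < T ->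
  (0 < psteps (prestr P T))%N.
Proof.
move=> Pf T0.
have m0 : 0 \in prestr P T.
  by rewrite (mem_prestr _ _ Pf) inE /= in_itv/= lexx ltW//; split=> //; right; left.
have mT : T \in prestr P T.
  by rewrite (mem_prestr _ _ Pf) inE /= in_itv/= lexx ltW//; split=> //; right; right.
rewrite /psteps; case: (prestr P T) m0 mT => [//|a [|//]] /=.
rewrite !inE => /eqP <- /eqP T00.
by rewrite T00 ltxx in T0.
Qed.

(* In RIE the two suprema are added in \bar R, where
   -oo + +oo = -oo: the bound on the sum bounds the first supremum only
   because the second one is not over the empty set. *)
Lemma RIE_path_bound (p T : R) (pi : nat -> seq R) S :
  (0 < psteps (pi 0%N))%N -> RIE p pi T S -> 0 <= T ->
  exists C w, [/\ 0 <= C, control T w &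
    forall s t, 0 <= s -> s <= t -> t <= T -> `|incr S s t| `^ p <= C * w s t].
Proof.
move=> pi0 [_ _ [w [w0 wD] le1]] T0.
set X := ereal_sup _ in le1; set Y := ereal_sup _ in le1.
(* The ratio of the first step lies above [-oo] whatever the sign of [w]: division by 0 gives
   [a * +oo], which is nonnegative, and otherwise the ratio is real. *)
have Yn : (-oo < Y)%E.
  pose a := `|incr (step_int S (pi 0%N)) (pi 0%N)`_0 (pi 0%N)`_1 -
     tens (S (pi 0%N)`_0) (incr S (pi 0%N)`_0 (pi 0%N)`_1)| `^ (p / 2).
  have : (a%:E / (w (pi 0%N)`_0 (pi 0%N)`_1)%:E <= Y)%E.
    by apply: ereal_sup_ubound; exists 0%N, 0%N, 1%N; split.
  apply: lt_le_trans; rewrite inver; case: ifPn => _; last by rewrite -EFinM ltNyr.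
  by apply: (@lt_le_trans _ _ 0%E) => //; rewrite mule_ge0// lee_fin powR_ge0.
have Xle s t : 0 <= s -> s <= t -> t <= T ->
    ((`|incr S s t| `^ p)%:E / (w s t)%:E <= X)%E.
  by move=> *; apply: ereal_sup_ubound; exists s, t; split.
have X0 : (0 <= X)%E.
  apply: le_trans (Xle 0 0 _ _ _) => //.
  rewrite inver; case: ifPn => _; first by rewrite mule_ge0// lee_fin powR_ge0.
  by rewrite -EFinM lee_fin mulr_ge0// ?powR_ge0// invr_ge0 w0.
(* As [Y] is above [-oo], [X = +oo] would make the sum [+oo], against [le1]. *)
have Xy : (X < +oo)%E.
  rewrite ltey; apply/eqP => Xy; move: le1; rewrite Xy addye.
    by rewrite leNgt ltry.
  by rewrite -ltNye.
have Xfin : X \is a fin_num by rewrite ge0_fin_numE.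
exists (fine X), w; split => //; first exact: fine_ge0.
move=> s t s0 st tT; have := Xle s t s0 st tT; rewrite -(fineK Xfin) inver.
case: eqP => [->|/eqP wn0]; last first.
  by rewrite -EFinM lee_fin ler_pdivrMr// lt0r wn0 w0.
(* Where [w s t = 0] the increment must vanish: a positive numerator over 0 would be [+oo], above
   the finite [X]. *)
rewrite mulr0; have := powR_ge0 `|incr S s t| p.
rewrite le_eqVlt => /predU1P[<-//|Sp].
by rewrite gt0_muley ?lte_fin// leNgt ltry.
Qed.

Lemma cadlag_comp {V : normedModType R} (a : R) (b : \bar R)
    (g : 'rV[R]_d -> V) S :
  continuous g -> 0 <= a -> cadlag 0 +oo%E S -> cadlag a b (g \o S).
Proof.
move=> cg a0 [Sr Sl]; split=> t at_ _.
  exact: (continuous_cvg _ (cg _) (Sr _ (le_trans a0 at_) (ltry _))).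
have /cvg_ex[l Stl] := Sl t (le_lt_trans a0 at_) (leey _).
by apply/cvg_ex; exists (g l); exact: (continuous_cvg _ (cg _) Stl).
Qed.

Lemma indic_itvco_near (a b t : R) : t != a -> t != b ->
  \forall x \near t, \1_(`[a, b[%classic) x = \1_(`[a, b[%classic) t :> R.
Proof.
move=> ta tb.
have H (c : R) : t != c ->
    \forall x \near t, (c <= x) = (c <= t) /\ (x < c) = (t < c).
  move=> tc; have [ct|ct|ct] := ltgtP t c; last by rewrite ct eqxx in tc.
  - by apply: filterS (lt_nbhsl ct) => x xc; rewrite leNgt xc.
  - by apply: filterS (lt_nbhsr ct) => x xc; rewrite ltNge ltW.
apply: filterS2 (H _ ta) (H _ tb) => x [ax _] [_ xb].
by rewrite !indicE !mem_setE !in_itv/= ax xb.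
Qed.

Lemma step_path_near S (pi : seq R) (T t : R) :
  (0 < size pi)%N -> t != T -> t \notin pi ->
  \forall x \near t, step_path S pi T x = step_path S pi T t.
Proof.
move=> pi0 tT tpi.
have npi k : (k < size pi)%N -> t != pi`_k.
  by move=> kpi; apply: contraNneq tpi => ->; exact: mem_nth.
have : \forall x \near t, forall k : 'I_(psteps pi),
    \1_(`[pi`_k, pi`_k.+1[%classic) x = \1_(`[pi`_k, pi`_k.+1[%classic) t :> R.
  apply: (@filter_forall R 'I_(psteps pi) (fun k x =>
    \1_(`[pi`_k, pi`_k.+1[%classic) x = \1_(`[pi`_k, pi`_k.+1[%classic) t)
    _ (nbhs_filter t)) => k.
  have kpi : (k.+1 < size pi)%N by rewrite -ltn_predRL ltn_ord.
  by apply: indic_itvco_near; apply: npi => //; exact: ltnW.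
have : \forall x \near t, x != T by exact: open_neq.
apply: filterS2 => x xT ind; rewrite /step_path !indicE.
rewrite !memNset ?scale0r ?add0r//=; [|exact/eqP|exact/eqP].
by apply: eq_bigr => k _; rewrite ind.
Qed.

(* Off the partition points the step paths are locally constant, so that their
   uniform limit is continuous there. *)
Lemma left_continuous_off_partitions (p : R) (P : nat -> set R) S (t : R) :
  price_path p P S -> 0 < t -> (forall n, ~ P n t) ->
  S x @[x --> t^'-] --> S t.
Proof.
(* The choice [T = t + 1] keeps [t] away from the endpoint [T], which [prestr] adds to every
   partition. *)
move=> [_ Pf _ _ rie] t0 Pt; pose T := t + 1.
have tT : t < T by rewrite ltrDl.
have T0 : 0 < T by rewrite (lt_trans t0).
have [unif _ _] := rie _ T0.
apply: cvg_at_left_filter; apply/cvgrPdist_lt => e e0.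
have e30 : 0 < e / 3 by rewrite divr_gt0.
(* Uniformity gives one [n] whose error is below [e / 3] at [t] and at all nearby [x]
   simultaneously. *)
have [n Hn] : exists n, forall y, `[0, T]%classic y ->
    ball (S y) (e / 3) (step_path S (prestr (P n) T) T y).
  have /unif : nbhs (S : {uniform` `[0, T]%classic -> 'rV[R]_d})
      [set h | forall y, `[0, T]%classic y -> ball (S y) (e / 3) (h y)].
    apply/uniform_nbhs.
    exists [set xy | ball xy.1 (e / 3) xy.2]; split => //.
    exact: entourage_ball (PosNum e30).
  by move=> [N _ HN]; exists N; apply: HN => /=.
have tpi : t \notin prestr (P n) T.
  rewrite (mem_prestr _ _ (Pf n)) notin_setE => -[[/Pt//|[tt|tt] _]].
    by rewrite tt ltxx in t0.
  by rewrite tt ltxx in tT.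
have szpi : (0 < size (prestr (P n) T))%N.
  by have := psteps_prestr_gt0 (Pf n) T0; rewrite /psteps; case: size.
have xnear : \forall x \near t, x \in `[0, T].
  apply: filterS2 (lt_nbhsr t0) (lt_nbhsl tT) => x x0 xT.
  by rewrite in_itv/= !ltW.
have := step_path_near S szpi (negbT (lt_eqF tT)) tpi.
apply: filterS2 xnear => x xT xt.
have /Hn := xT; rewrite -ball_normE /= xt => Hx.
have /Hn : `[0, T]%classic t by rewrite /= in_itv/= !ltW.
rewrite -ball_normE /= => Ht.
set s := step_path _ _ _ _ in Hx Ht.
(* The step path takes the same value [s] at [x] and at [t], so only two errors below [e / 3]
   remain. *)
rewrite (_ : S t - S x = (S t - s) - (S x - s)); last first.
  by rewrite opprB addrA subrK.
rewrite (le_lt_trans (ler_normB _ _))//.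
rewrite (lt_le_trans (ltrD Ht Hx))// -mulrDl ler_pdivrMr//.
by rewrite -mulr2n -[leLHS]mulr_natr ler_pM2l// ler_nat.
Qed.

(** Reduces admissibility to deterministic estimates on the pair [(G, G')]: the Lipschitz bounds
    serve the path and its derivative, the quadratic bound the remainder. *)
Lemma admissible_comp (p : R) (P : nat -> set R) S
    (G : 'rV[R]_d -> 'rV[R]_d) (G' : 'rV[R]_d -> 'M[R]_d) (K : R) :
  2 < p < 3 -> price_path p P S -> 0 <= K ->
  (forall x y, `|G y - G x| <= K * `|y - x|) ->
  (forall x y, `|G' y - G' x| <= K * `|y - x|) ->
  (forall x y, `|G y - G x - (y - x) *m G' x| <= K * `|y - x| ^+ 2) ->
  admissible p P S (G \o S).
Proof.
move=> /andP[p2 p3] Spp K0 GK G'K RK.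
have p0 : 0 < p by rewrite (lt_trans _ p2).
have cG := continuous_of_lipschitz GK; have cG' := continuous_of_lipschitz G'K.
have [Sc Pf _ _ Srie] := Spp.
split; last first.
  move=> t t0; apply: contra_notP => /forallNP nPt.
  apply: cvg_lim => //.
  exact: (continuous_cvg _ (cG _) (left_continuous_off_partitions Spp t0 nPt)).
(* With [q = p], the condition [1 < r] reads [2 < p], and [1 < 2 / p + 1 / q] reads [1 < 3 / p],
   that is [p < 3]. *)
exists p, (p / 2); split => //.
- by rewrite ltr_pdivlMr// mul1r.
- by rewrite -mulrDl ltr_pdivlMr// mul1r (lt_le_trans p3)// -natr1.
- by rewrite div1r invf_div mulrDl -mulrDl.
move=> T T0; exists (G' \o S).
have [C [w [C0 cw Sw]]] :=
  RIE_path_bound (psteps_prestr_gt0 (Pf 0%N) T0) (Srie _ T0) (ltW T0).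
have lip (V : normedModType R) (H : 'rV[R]_d -> V) s t :
    (forall x y, `|H y - H x| <= K * `|y - x|) ->
    0 <= s -> s <= t -> t <= T -> `|incr (H \o S) s t| `^ p <= K `^ p * C * w s t.
  move=> HK s0 st tT; rewrite -mulrA.
  apply: (le_trans _ (ler_wpM2l (powR_ge0 _ _) (Sw _ _ s0 st tT))).
  rewrite -powRM//; apply: ge0_ler_powR; rewrite ?nnegrE ?mulr_ge0// ?(ltW p0)//.
  exact: HK.
split.
- split; first exact: cadlag_comp.
  apply: (p_variation_lty (C := K `^ p * C) cw).
    by rewrite mulr_ge0// powR_ge0.
  by move=> s t; exact: lip.
- split; first exact: cadlag_comp.
  apply: (p_variation_lty (C := K `^ p * C) cw).
    by rewrite mulr_ge0// powR_ge0.
  by move=> s t; exact: lip.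
- split.
  (* With one time frozen, the remainder is a continuous function of the price at the other time, so
     it is càdlàg there. *)
  + move=> s /andP[s0 _].
    apply: (@cadlag_comp _ s T%:E (fun y =>
      G y - G (S s) - (y - S s) *m G' (S s))) => // y.
    exact: (cvgB (cvgB (cG y) (cvg_cst _))
      (cvg_mulmx (cvgB cvg_id (cvg_cst _)) (cvg_cst _))).
  + move=> t _.
    apply: (@cadlag_comp _ 0 t%:E (fun x =>
      G (S t) - G x - (S t - x) *m G' x)) => // x.
    exact: (cvgB (cvgB (cvg_cst _) (cG x))
      (cvg_mulmx (cvgB (cvg_cst _) cvg_id) (cG' x))).
  + apply: (p_variation_lty (C := K `^ (p / 2) * C) cw).
      by rewrite mulr_ge0// powR_ge0.
    move=> s t s0 st tT; rewrite -mulrA.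
    apply: (le_trans _ (ler_wpM2l (powR_ge0 _ _) (Sw _ _ s0 st tT))).
    (* The quadratic bound raised to [p / 2] restores the exponent [p] on the increment, so the same
       control [w] serves. *)
    have -> : `|incr S s t| `^ p = (`|incr S s t| ^+ 2) `^ (p / 2).
      by rewrite -powR_mulrn// -powRrM mulrC divfK.
    rewrite -powRM ?sqr_ge0//; apply: ge0_ler_powR.
    * by rewrite divr_ge0// ltW.
    * by rewrite nnegrE.
    * by rewrite nnegrE mulr_ge0// sqr_ge0.
    * exact: RK.
Qed.

End RIE_path.

(** * Mean value theorem for Jacobians *)

Section MVT_jacobian.
Context {R : realType} {d m : nat}.
Implicit Type g : 'rV[R]_d -> 'rV[R]_m.

Lemma row_jacobian g x i : row i (jacobian g x) = 'd g x (delta_mx ord0 i).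
Proof. by rewrite rowE /jacobian mul_rV_lin1. Qed.

Lemma jacobianB g h x : differentiable g x -> differentiable h x ->
  jacobian (g \- h) x = jacobian g x - jacobian h x.
Proof.
move=> dg dh; have E (v : 'rV[R]_d) : 'd (g \- h) x v = 'd g x v - 'd h x v.
  exact: (congr1 (@^~ v) (diffB dg dh)).
apply/row_matrixP => i; rewrite raddfB /=.
apply: (etrans (row_jacobian (g \- h) x i)); apply: (etrans (E _)).
by congr (_ - _); exact/esym/row_jacobian.
Qed.

(** The scalar mean value theorem is applied to the [j]-th coordinate along the segment from [x] to
    [y]. The intermediate point depends on [j], hence a statement for each coordinate. *)
Lemma MVT_segment g (x y : 'rV[R]_d) (j : 'I_m) :
  (forall z, differentiable g z) ->
  exists2 c, 0 < c < 1 &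
    (g y - g x) ord0 j = ((y - x) *m jacobian g (x + c *: (y - x))) ord0 j.
Proof.
move=> dg; pose v := y - x; pose k (u : R) := g (x + u *: v) ord0 j.
have dk (u : R) : is_derive u 1 k ((v *m jacobian g (x + u *: v)) ord0 j).
  have dgu := diff_derivable (v := v) (dg (x + u *: v)).
  rewrite -deriveEjacobian//.
  (* The difference quotient of [k] is the [j]-th coordinate of that of [g] in direction [v]. *)
  have H : (fun h : R => h^-1 *: (k (h *: 1 + u) - k u)) @ 0^' -->
      ('D_v g (x + u *: v)) ord0 j.
    have -> : (fun h : R => h^-1 *: (k (h *: 1 + u) - k u)) =
       (fun M : 'rV[R]_m => M ord0 j) \o
       (fun h : R => h^-1 *: (g (h *: v + (x + u *: v)) - g (x + u *: v))).
      apply/funext => h /=; rewrite !mxE /k.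
      by rewrite [h *: 1]mulr1 scalerDl addrCA.
    exact: (continuous_cvg _ (@coord_continuous _ _ _ ord0 j _) dgu).
  split; last exact: cvg_lim H.
  by apply/cvg_ex; exists (('D_v g (x + u *: v)) ord0 j).
have ck : continuous k.
  by move=> u; apply/differentiable_continuous/derivable1_diffP; case: (dk u).
have [c c01 kc] := MVT ltr01 (fun u _ => dk u) (continuous_subspaceT ck).
exists c; first by rewrite in_itv in c01.
have -> : (g y - g x) ord0 j = k 1 - k 0.
  by rewrite /k scale1r scale0r addr0 /v [x + _]addrC subrK !mxE.
by rewrite kc subr0 mulr1.
Qed.

Lemma jacobian_lipschitz g (L : R) : (forall z, differentiable g z) ->
  (forall z, `|jacobian g z| <= L) ->
  forall x y, `|g y - g x| <= d%:R * L * `|y - x|.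
Proof.
move=> dg gL x y; have L0 : 0 <= L by rewrite (le_trans _ (gL 0)).
apply: norm_mx_le => [|i j]; first by rewrite !mulr_ge0.
rewrite ord1; have [c _ ->] := MVT_segment x y j dg.
rewrite (le_trans (norm_entry_le _ _ _))// (le_trans (norm_mulmx_le _ _))//.
by rewrite mulrAC ler_wpM2r// ler_wpM2l.
Qed.

End MVT_jacobian.

(** * Elementary properties of the C^2_b norm *)

Section C2b_bounds.
Context {R : realType} {d : nat}.
Implicit Types f g : 'rV[R]_d -> 'rV[R]_d.

Lemma sup_norm_ge {V : normedModType R} (u : 'rV[R]_d -> V) x :
  (`|u x|%:E <= sup_norm u)%E.
Proof. by apply: ereal_sup_ubound; exists x. Qed.

Lemma sup_norm_ge0 {V : normedModType R} (u : 'rV[R]_d -> V) :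
  (0 <= sup_norm u)%E.
Proof. by rewrite (le_trans _ (sup_norm_ge u 0))// lee_fin. Qed.

Lemma sup_norm_triangle {V : normedModType R} (u v : 'rV[R]_d -> V) :
  (sup_norm u <= sup_norm v + sup_norm (u \- v)%R)%E.
Proof.
apply: ge_ereal_sup => _ [x _ <-].
apply: (@le_trans _ _ (`|v x| + `|u x - v x|)%:E).
  by rewrite lee_fin -{1}(subrK (v x) (u x)) addrC ler_normD.
by rewrite EFinD; apply: leeD; [exact: sup_norm_ge|exact: (sup_norm_ge (u \- v))].
Qed.

Lemma D1B f g : (forall x, differentiable f x) -> (forall x, differentiable g x) ->
  D1 (f \- g) = D1 f \- D1 g.
Proof. by move=> df dg; apply/funext => x; rewrite /D1 jacobianB. Qed.

Lemma D2B f g : is_C2 f -> is_C2 g -> D2 (f \- g) = D2 f \- D2 g.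
Proof.
move=> [df df1 _] [dg dg1 _]; apply/funext => x.
pose vf y := mxvec (D1 f y); pose vg y := mxvec (D1 g y).
rewrite /D2 D1B// (_ : (fun y => mxvec _) = vf \- vg); last first.
  by apply/funext => y; rewrite /= raddfB.
exact: (jacobianB (df1 x) (dg1 x)).
Qed.

(** Makes the norm 1-Lipschitz, the source of its Borel measurability. [is_C2] lets [D1] and [D2]
    commute with subtraction. *)
Lemma C2b_norm_triangle f g : is_C2 f -> is_C2 g ->
  (C2b_norm f <= C2b_norm g + C2b_norm (f \- g)%R)%E.
Proof.
move=> f2 g2; have [df _ _] := f2; have [dg _ _] := g2.
rewrite /C2b_norm D1B// D2B// addeACA [X in (_ <= X + _)%E]addeACA.
by apply: leeD; [apply: leeD|]; exact: sup_norm_triangle.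
Qed.

Lemma le_C2b_norm f x : [/\ (`|f x|%:E <= C2b_norm f)%E,
  (`|D1 f x|%:E <= C2b_norm f)%E & (`|D2 f x|%:E <= C2b_norm f)%E].
Proof.
have := (sup_norm_ge0 f, sup_norm_ge0 (D1 f), sup_norm_ge0 (D2 f)).
move=> [[f0 f1] f2]; rewrite /C2b_norm; split.
- by rewrite -addeA (le_trans (sup_norm_ge _ _))// leeDl// adde_ge0.
- by rewrite addeAC (le_trans (sup_norm_ge _ x))// leeDr// adde_ge0.
- by rewrite (le_trans (sup_norm_ge _ x))// leeDr// adde_ge0.
Qed.

End C2b_bounds.

(** * Estimates for a single function, and measurability in the function *)

Section C2b_integrals.
Context {R : realType} {d : nat}.

(** [C2b_prop] makes the norm finite, so [fine] loses nothing and real integrals apply. *)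
Definition C2bn (f : C2b R d) : R := fine (C2b_norm f).

Lemma C2bnE (f : C2b R d) : (C2bn f)%:E = C2b_norm f.
Proof.
have [n0 _ _] := le_C2b_norm f 0.
rewrite /C2bn fineK// ge0_fin_numE; first exact: (C2b_prop f).2.
by rewrite (le_trans _ n0)// lee_fin.
Qed.

Lemma C2bn_ge0 f : 0 <= C2bn f.
Proof. by have [+ _ _] := le_C2b_norm f 0; rewrite -C2bnE lee_fin; exact: le_trans. Qed.

Lemma C2b_fun_le (f : C2b R d) x : `|f x| <= C2bn f.
Proof. by have [+ _ _] := le_C2b_norm f x; rewrite -C2bnE. Qed.

Lemma C2b_D1_le (f : C2b R d) x : `|D1 f x| <= C2bn f.
Proof. by have [_ + _] := le_C2b_norm f x; rewrite -C2bnE. Qed.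

Lemma C2b_D2_le (f : C2b R d) x : `|D2 f x| <= C2bn f.
Proof. by have [_ _ +] := le_C2b_norm f x; rewrite -C2bnE. Qed.

Lemma C2b_differentiable (f : C2b R d) x : differentiable f x.
Proof. by have [[+ _ _] _] := C2b_prop f; exact. Qed.

Lemma C2b_lipschitz (f : C2b R d) x y :
  `|f y - f x| <= d%:R * C2bn f * `|y - x|.
Proof.
by apply: jacobian_lipschitz; [exact: C2b_differentiable|exact: C2b_D1_le].
Qed.

Lemma C2b_D1_lipschitz (f : C2b R d) x y :
  `|D1 f y - D1 f x| <= d%:R * C2bn f * `|y - x|.
Proof.
have [[_ df1 _] _] := C2b_prop f.
apply: le_trans (jacobian_lipschitz df1 (C2b_D2_le f) x y).
(* [mxvec] only relabels entries, so flattening preserves the maximum norm. *)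
apply: norm_mx_le => // i j; rewrite -mxvecE raddfB /=; exact: norm_entry_le.
Qed.

(** In each coordinate the mean value theorem turns the remainder into that of
    [w *m (D1 f z - D1 f x)] with [z] on the segment. One factor [d%:R] comes from the product, the
    other from the Lipschitz bound on [D1 f]. *)
Lemma C2b_taylor (f : C2b R d) x y :
  `|f y - f x - (y - x) *m D1 f x| <= d%:R ^+ 2 * C2bn f * `|y - x| ^+ 2.
Proof.
apply: norm_mx_le => [|i j]; first by rewrite !mulr_ge0// C2bn_ge0.
have [c /andP[c0 c1] E] := MVT_segment x y j (C2b_differentiable f).
set w := y - x in E *; set z := x + _ in E.
have -> : (f y - f x - w *m D1 f x) i j = (w *m (D1 f z - D1 f x)) ord0 j.
  by rewrite ord1 [LHS]mxE E mulmxBr [RHS]mxE.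
rewrite (le_trans (norm_entry_le _ _ _))// (le_trans (norm_mulmx_le _ _))//.
rewrite (le_trans (ler_wpM2l _ (C2b_D1_lipschitz f x z)))// ?mulr_ge0//.
rewrite /z addrAC subrr add0r normrZ gtr0_norm//.
have -> : d%:R * `|w| * (d%:R * C2bn f * (c * `|w|)) =
  d%:R ^+ 2 * C2bn f * `|w| ^+ 2 * c by ring.
by rewrite ler_piMr ?(ltW c1)// !mulr_ge0 ?sqr_ge0 ?C2bn_ge0.
Qed.

(* One-sided Lipschitz bounds suffice: they make {h < c} open in the norm. *)
Lemma C2b_measurable_fun (h : C2b R d -> R) :
  (forall f g, ((h g - h f)%:E <= C2b_norm (g \- f)%R)%E) ->
  measurable_fun setT h.
Proof.
move=> hle; apply: (measurability _ (RGenInftyO.measurableE R)).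
move=> _ [_ [c ->] <-]; rewrite setTI; apply: sub_sigma_algebra => f /=.
rewrite in_itv/= => hfc; exists (c - h f); first by rewrite subr_gt0.
move=> g /(le_lt_trans (hle f g)); rewrite lte_fin ltrD2r => hgc.
by rewrite /= in_itv.
Qed.

Lemma measurable_C2bn : measurable_fun [set: C2b R d] C2bn.
Proof.
apply: C2b_measurable_fun => f g.
have := C2b_norm_triangle (C2b_prop g).1 (C2b_prop f).1.
by rewrite -(C2bnE f) -(C2bnE g) EFinB leeBlDl.
Qed.

Lemma measurable_C2b_coord x i :
  measurable_fun [set: C2b R d] (fun f => f x ord0 i).
Proof.
apply: C2b_measurable_fun => f g.
have [+ _ _] := le_C2b_norm ((g : _ -> _) \- f) x; apply: le_trans.
by rewrite lee_fin (le_trans (ler_norm _))//; exact: norm_entryB_le.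
Qed.

Lemma measurable_C2b_D1_coord x i j :
  measurable_fun [set: C2b R d] (fun f => D1 f x i j).
Proof.
apply: C2b_measurable_fun => f g.
have [_ + _] := le_C2b_norm ((g : _ -> _) \- f) x; apply: le_trans.
rewrite D1B; [|exact: C2b_differentiable..].
by rewrite lee_fin (le_trans (ler_norm _))//; exact: norm_entryB_le.
Qed.

End C2b_integrals.

(** * Averages over [Z] of the functions and of their derivatives *)

Lemma Rintegral_sum d (T : measurableType d) (R : realType)
    (mu : {measure set T -> \bar R}) (D : set T) (mD : measurable D) (I : Type)
    (s : seq I) (h : I -> T -> R) :
  (forall i, mu.-integrable D (EFin \o h i)) ->
  \int[mu]_(x in D) (\sum_(i <- s) h i x) =
  \sum_(i <- s) \int[mu]_(x in D) h i x.
Proof.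
move=> ih; rewrite /Rintegral; under eq_integral do rewrite -sumEFin.
rewrite (@integral_sum _ _ _ mu D mD I (fun i => EFin \o h i) ih).
by rewrite -sum_fine// => i _; exact: integrable_fin_num.
Qed.

Section C2b_mean.
Context {R : realType} {d : nat} (nu : {measure set (C2b R d) -> \bar R}).
Context (Z : set (C2b R d)) (mZ : measurable Z).
Context (hint : (\int[nu]_(f in Z) C2b_norm f < +oo)%E).

(** Composed with [S], this unfolds to [universal_portfolio Z nu S]. *)
Definition mean_fun x : 'rV[R]_d := \row_i (\int[nu]_(f in Z) f x ord0 i).
Definition mean_D1 x : 'M[R]_d := \matrix_(i, j) (\int[nu]_(f in Z) D1 f x i j).

Lemma integrable_C2bn : nu.-integrable Z (EFin \o C2bn).
Proof.
apply/integrableP; split.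
  by apply/measurable_EFinP; apply: measurable_funTS; exact: measurable_C2bn.
apply: le_lt_trans hint; rewrite le_eqVlt; apply/orP; left; apply/eqP.
by apply: eq_integral => f _; rewrite /= ger0_norm ?C2bn_ge0// C2bnE.
Qed.

Lemma integrable_le_C2bn (h : C2b R d -> R) : measurable_fun setT h ->
  (forall f, `|h f| <= C2bn f) -> nu.-integrable Z (EFin \o h).
Proof.
move=> mh hn; apply: le_integrable integrable_C2bn => //.
  by apply/measurable_EFinP; exact: measurable_funTS.
by move=> f _ /=; rewrite lee_fin (le_trans (hn f))// ler_norm.
Qed.

Lemma integrable_C2b_coord x i :
  nu.-integrable Z (EFin \o (fun f : C2b R d => f x ord0 i)).
Proof.
apply: integrable_le_C2bn (measurable_C2b_coord x i) _ => f.
exact: le_trans (norm_entry_le _ _ _) (C2b_fun_le f x).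
Qed.

Lemma integrable_C2b_D1_coord x i j :
  nu.-integrable Z (EFin \o (fun f : C2b R d => D1 f x i j)).
Proof.
apply: integrable_le_C2bn (measurable_C2b_D1_coord x i j) _ => f.
exact: le_trans (norm_entry_le _ _ _) (C2b_D1_le f x).
Qed.

(** Common tool for the three estimates below: once a difference or remainder is written as a single
    integral, its pointwise bound, linear in the norm of [f], integrates to the same bound. *)
Lemma norm_Rintegral_le_C2bn (h : C2b R d -> R) (c : R) :
  nu.-integrable Z (EFin \o h) -> (forall f, `|h f| <= C2bn f * c) ->
  `|\int[nu]_(f in Z) h f| <= (\int[nu]_(f in Z) C2bn f) * c.
Proof.
move=> ih hc; rewrite (le_trans (le_normr_Rintegral mZ ih))//.
rewrite -RintegralZr//; last exact: integrable_C2bn.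
apply: le_Rintegral => //; first exact: integrable_norm ih.
exact: (integrableZr mZ c integrable_C2bn).
Qed.

Lemma Rintegral_C2bn_ge0 : 0 <= \int[nu]_(f in Z) C2bn f.
Proof. by apply: Rintegral_ge0 => f _; exact: C2bn_ge0. Qed.

Lemma mean_fun_lipschitz x y :
  `|mean_fun y - mean_fun x| <= (\int[nu]_(f in Z) C2bn f) * (d%:R * `|y - x|).
Proof.
apply: norm_mx_le => [|i j]; first by rewrite !mulr_ge0// Rintegral_C2bn_ge0.
have iy := integrable_C2b_coord y j; have ix := integrable_C2b_coord x j.
rewrite !mxE -RintegralB//; apply: norm_Rintegral_le_C2bn.
  exact: (integrableB mZ iy ix).
move=> f; apply: le_trans (norm_entryB_le (f y) (f x) ord0 j) _.
by rewrite mulrA [_ * d%:R]mulrC; exact: C2b_lipschitz.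
Qed.

Lemma mean_D1_lipschitz x y :
  `|mean_D1 y - mean_D1 x| <= (\int[nu]_(f in Z) C2bn f) * (d%:R * `|y - x|).
Proof.
apply: norm_mx_le => [|i j]; first by rewrite !mulr_ge0// Rintegral_C2bn_ge0.
have iy := integrable_C2b_D1_coord y i j.
have ix := integrable_C2b_D1_coord x i j.
have -> : (mean_D1 y - mean_D1 x) i j =
    \int[nu]_(f in Z) (D1 f y i j - D1 f x i j).
  rewrite (RintegralB mZ iy ix) mxE [in X in _ + X]mxE.
  by congr (_ - _); rewrite mxE.
apply: norm_Rintegral_le_C2bn; first exact: (integrableB mZ iy ix).
move=> f; apply: le_trans (norm_entryB_le (D1 f y) (D1 f x) i j) _.
by rewrite mulrA [_ * d%:R]mulrC; exact: C2b_D1_lipschitz.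
Qed.

(** The expansion is made for each [f] by [C2b_taylor] and then integrated, linearity of the
    integral turning averages of [D1 f] into [mean_D1]. *)
Lemma mean_fun_taylor x y :
  `|mean_fun y - mean_fun x - (y - x) *m mean_D1 x| <=
    (\int[nu]_(f in Z) C2bn f) * (d%:R ^+ 2 * `|y - x| ^+ 2).
Proof.
apply: norm_mx_le => [|i j].
  by rewrite !mulr_ge0 ?sqr_ge0// Rintegral_C2bn_ge0.
have iy := integrable_C2b_coord y j; have ix := integrable_C2b_coord x j.
have iyx := integrableB mZ iy ix.
(* [h k] is the [k]-th term of the product with [D1 f x]; as the sum is finite, the integral passes
   through [*m]. *)
pose h k (f : C2b R d) := (y - x) ord0 k * D1 f x k j.
have ih k : nu.-integrable Z (EFin \o h k).
  exact: (integrableZl mZ ((y - x) ord0 k) (integrable_C2b_D1_coord x k j)).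
have ihs : nu.-integrable Z (EFin \o (fun f => \sum_k h k f)).
  rewrite (_ : _ \o _ = fun f => (\sum_k (EFin \o h k) f)%E).
    exact: integrable_sum.
  by apply/funext => f /=; rewrite sumEFin.
have -> : (mean_fun y - mean_fun x - (y - x) *m mean_D1 x) i j =
    \int[nu]_(f in Z) (f y ord0 j - f x ord0 j - \sum_k h k f).
  rewrite (RintegralB mZ iyx ihs) (RintegralB mZ iy ix) (Rintegral_sum mZ _ ih).
  have entryBB (A B C : 'rV[R]_d) :
    (A - B - C) ord0 j = A ord0 j - B ord0 j - C ord0 j by rewrite !mxE.
  rewrite ord1 entryBB; congr (_ - _ - _); rewrite mxE//.
  by apply: eq_bigr => k _; rewrite [mean_D1 x k j]mxE RintegralZl//;
    exact: integrable_C2b_D1_coord.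
apply: norm_Rintegral_le_C2bn; first exact: (integrableB mZ iyx ihs).
move=> f; rewrite mulrA [_ * d%:R ^+ 2]mulrC; apply: le_trans (C2b_taylor f x y).
have -> : f y ord0 j - f x ord0 j - \sum_k h k f =
    (f y - f x) ord0 j - ((y - x) *m D1 f x) ord0 j.
  by rewrite [((y - x) *m _) _ _]mxE; congr (_ - _); rewrite !mxE.
exact: norm_entryB_le.
Qed.

End C2b_mean.

(* A probability measure on Z is a probability measure on C2b carried by Z. *)
Theorem lemma3p9 (R : realType) (d : nat) (p : R) (hp : 2 < p < 3)
    (S : R -> 'rV[R]_d) (P : nat -> set R) (hS : price_path p P S)
    (Z : set (C2b R d)) (mZ : measurable Z)
    (nu : probability (C2b R d) R) (nuZ : nu Z = 1%E)
    (hint : (\int[nu]_(f in Z) C2b_norm f < +oo)%E) :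
  admissible p P S (universal_portfolio Z nu S).
Proof.
(* [d%:R] comes from the two Lipschitz bounds and [d%:R ^+ 2] from the Taylor bound; their sum
   covers all three. *)
pose K := (\int[nu]_(f in Z) C2bn f) * (d%:R + d%:R ^+ 2).
have N0 : 0 <= \int[nu]_(f in Z) C2bn f by exact: Rintegral_C2bn_ge0.
have d20 : 0 <= d%:R ^+ 2 :> R by exact: sqr_ge0.
apply: (@admissible_comp _ _ _ _ _ (mean_fun nu Z) (mean_D1 nu Z) K) => //.
- by rewrite mulr_ge0// addr_ge0.
- move=> x y; apply: le_trans (mean_fun_lipschitz mZ hint x y) _.
  by rewrite mulrA ler_wpM2r// ler_wpM2l// lerDl.
- move=> x y; apply: le_trans (mean_D1_lipschitz mZ hint x y) _.
  by rewrite mulrA ler_wpM2r// ler_wpM2l// lerDl.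
- move=> x y; apply: le_trans (mean_fun_taylor mZ hint x y) _.
  by rewrite mulrA ler_wpM2r ?sqr_ge0// ler_wpM2l// lerDr.
Qed.
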